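(* Let $\mathbb{K}$ be a number field of degree $k$, $\mathcal{O}$ an order in $\mathbb{K}$ with $\mathbb{Z}$-basis $\omega_1=1,\ldots,\omega_k$, $p\in\mathcal{O}[x]$ monic, and $\mathcal{F}$ a bounded fundamental domain for the action of $\mathbb{Z}^k$ on $\mathbb{R}^k$. Suppose $\mathbf{0}\in\mathrm{int}(\mathcal{F}\cup(\mathcal{F}-\mathbf{e}_1))$ and $\mathbf{0}\in\mathrm{int}_+(\mathcal{F})$. Then there is $\eta>0$ such that $(p(x+\alpha),D_{\mathcal{F},p(\alpha)})$ has the finiteness property whenever $\alpha=m_1\omega_1+\cdots+m_k\omega_k\in\mathcal{O}$ ($m_j\in\mathbb{Z}$) satisfies $\max\{1,|m_2|,\ldots,|m_k|\}<\eta m_1$.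
   Context: A bounded fundamental domain for the action of $\mathbb{Z}^k$ on $\mathbb{R}^k$ is a bounded set $\mathcal{F}$ with $\mathbb{R}^k=\mathcal{F}+\mathbb{Z}^k$ and translates pairwise disjoint. For $\vartheta\in\mathcal{O}$, $D_{\mathcal{F},\vartheta}=\{\vartheta\sum_j f_j\omega_j:(f_1,\ldots,f_k)\in\mathcal{F}\}\cap\mathcal{O}$ (note $p(\alpha)$ is the constant term of $p(x+\alpha)$). A pair $(q,\mathcal{D})$ ($q$ monic in $\mathcal{O}[x]$, $\mathcal{D}$ complete residue system modulo $q(0)$ containing $0$) has the finiteness property if every $a\in\mathcal{O}[x]$ satisfies $a\equiv\sum_{j=0}^{\ell-1}d_jx^j\pmod q$ for some $\ell\in\mathbb{N}$, $d_j\in\mathcal{D}$. $\mathbf{e}_1=(1,0,\ldots,0)$; $\mathrm{int}$ is the interior in $\mathbb{R}^k$, and $\mathrm{int}_+$ is the interior with respect to the subspace topology of the half-space $\{(r_1,\ldots,r_k)\in\mathbb{R}^k:r_1\ge0\}$. *)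

(* Defs.v *)
From HB Require Import structures.
From mathcomp Require Import all_boot all_order all_algebra.
From Stdlib Require Import Rdefinitions Raxioms RIneq Rbasic_fun.
Set Implicit Arguments. Unset Strict Implicit. Unset Printing Implicit Defensive.
Import GRing.Theory.
Local Open Scope ring_scope.

Definition intR (z : int) : R :=
  match z with Posz n => INR n | Negz n => Ropp (INR n.+1) end.

Definition Zcomb (A : ringType) (n : nat) (w : 'I_n -> A) (m : {ffun 'I_n -> int}) : A :=
  \sum_(i < n) w i *~ m i.

Definition is_Zbasis (A : ringType) (n : nat) (w : 'I_n -> A) : Prop :=
  forall x : A, exists! m : {ffun 'I_n -> int}, x = Zcomb w m.

Definition rvec (n : nat) := 'I_n -> R.
Definition rzero (n : nat) : rvec n := fun _ => R0.
Definition e1 (n : nat) : rvec n.+1 := fun i => if i == ord0 then R1 else R0.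
Definition radd (n : nat) (u v : rvec n) : rvec n := fun i => Rplus (u i) (v i).

Definition fundamental_domain (n : nat) (F : rvec n -> Prop) : Prop :=
  forall v : rvec n, exists! z : {ffun 'I_n -> int},
    F (fun i => Rminus (v i) (intR (z i))).

Definition bounded_set (n : nat) (F : rvec n -> Prop) : Prop :=
  exists B : R, forall f, F f -> forall i, Rle (Rabs (f i)) B.

Definition in_interior (n : nat) (S : rvec n -> Prop) (x : rvec n) : Prop :=
  exists eps : R, Rlt R0 eps /\
    forall v : rvec n, (forall i, Rlt (Rabs (Rminus (v i) (x i))) eps) -> S v.

Definition in_interior_plus (n : nat) (S : rvec n.+1 -> Prop) (x : rvec n.+1) : Prop :=
  Rle R0 (x ord0) /\
  exists eps : R, Rlt R0 eps /\
    forall v : rvec n.+1, Rle R0 (v ord0) ->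
      (forall i, Rlt (Rabs (Rminus (v i) (x i))) eps) -> S v.

(* D_{F,theta} = { theta * sum_j f_j w_j : f in F } \cap O, computed in
   K (x) R = R-span of the w_j, i.e. in coordinates: beta in O has
   coordinates b with b_l = sum_j c_{j,l} f_j where theta*w_j = sum_l c_{j,l} w_l. *)
Definition DF (A : ringType) (n : nat) (w : 'I_n -> A) (F : rvec n -> Prop) (theta : A)
  : A -> Prop :=
  fun beta => exists f : rvec n, F f /\
    exists (b : {ffun 'I_n -> int}) (c : 'I_n -> {ffun 'I_n -> int}),
      beta = Zcomb w b /\ (forall j, theta * w j = Zcomb w (c j)) /\
      forall l, intR (b l) = \big[Rplus/R0]_(j < n) Rmult (intR (c j l)) (f j).

Definition complete_residue_system (A : ringType) (theta : A) (D : A -> Prop) : Prop :=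
  forall x : A, exists! d : A, D d /\ exists c : A, x - d = theta * c.

Definition poly_congr (A : ringType) (q a b : {poly A}) : Prop :=
  exists c : {poly A}, a - b = c * q.

Definition finiteness_property (A : ringType) (q : {poly A}) (D : A -> Prop) : Prop :=
  q \is monic /\ complete_residue_system q.[0] D /\ D 0 /\
  forall a : {poly A}, exists (l : nat) (d : 'I_l -> A),
    (forall j, D (d j)) /\ poly_congr q a (\sum_(j < l) (d j)%:P * 'X^j).

(* Main.v *)
(** Write q(x) = p(x + alpha) and divide [a] by [q] from the constant term
upwards: choosing coefficients c_0, c_1, ... greedily so that each coefficient
of a - (sum_i c_i x^i) q becomes a digit, the finiteness property holds as soon
as c_i = 0 for all large [i]. In the coordinates of the basis [w], past the
degree of [a], c_i is the unique integer vector z with -r_i - z in [F], where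
r_i = sum_(j >= 1) c_(i-j) q_j / q_0. Since alpha / m_1 tends to 1 as [eta]
tends to 0, q_j / q_0 = m_1^(-j) (binomial(d, j) + o(1)): these multipliers are
small and have a nonnegative first coordinate. Smallness makes the c_i
eventually bounded, hence r_i tiny, hence c_i in {0, -e_1} by the first
hypothesis on [F]; from then on -r_i has nonnegative first coordinate, and the
second hypothesis gives c_i = 0. *)
Require Import Defs.
From Stdlib Require Import Rdefinitions Raxioms RIneq Rbasic_fun.
From HB Require Import structures.
From mathcomp Require Import all_boot all_order all_algebra.
From mathcomp Require Import boolp Rstruct zify lra.
Set Implicit Arguments.
Unset Strict Implicit.
Unset Printing Implicit Defensive.
Import Order.TTheory GRing.Theory Num.Theory.
Local Open Scope ring_scope.

(** * The entrywise l1 norm of matrices *)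

Section EntrywiseNorm.
Variable K : realFieldType.

Definition mxnorm (m n : nat) (A : 'M[K]_(m, n)) : K := \sum_i \sum_j `|A i j|.

Lemma mxnorm_ge0 m n (A : 'M[K]_(m, n)) : 0 <= mxnorm A.
Proof. by apply: sumr_ge0 => i _; apply: sumr_ge0. Qed.

Lemma mxnorm0 m n : mxnorm (0 : 'M[K]_(m, n)) = 0.
Proof. by apply: big1 => i _; apply: big1 => j _; rewrite mxE normr0. Qed.

Lemma ler_mxnorm_entry m n (A : 'M[K]_(m, n)) i j : `|A i j| <= mxnorm A.
Proof.
rewrite /mxnorm (bigD1 i) //= (bigD1 j) //= -addrA lerDl addr_ge0 //.
  exact: sumr_ge0.
by apply: sumr_ge0 => *; apply: sumr_ge0.
Qed.

Lemma mxnorm_eq0 m n (A : 'M[K]_(m, n)) : mxnorm A <= 0 -> A = 0.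
Proof.
move=> A0; apply/matrixP => i j; rewrite mxE; apply/eqP; rewrite -normr_le0.
exact: le_trans (ler_mxnorm_entry A i j) A0.
Qed.

Lemma mxnormN m n (A : 'M[K]_(m, n)) : mxnorm (- A) = mxnorm A.
Proof. by apply: eq_bigr => i _; apply: eq_bigr => j _; rewrite mxE normrN. Qed.

Lemma ler_mxnormD m n (A B : 'M[K]_(m, n)) :
  mxnorm (A + B) <= mxnorm A + mxnorm B.
Proof.
rewrite -big_split; apply: ler_sum => i _; rewrite -big_split.
by apply: ler_sum => j _; rewrite mxE ler_normD.
Qed.

Lemma ler_mxnorm_sum m n (I : Type) (r : seq I) (P : pred I)
    (X : I -> 'M[K]_(m, n)) :
  mxnorm (\sum_(i <- r | P i) X i) <= \sum_(i <- r | P i) mxnorm (X i).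
Proof.
elim/big_rec2: _ => [|i y x _ le_xy]; first by rewrite mxnorm0.
by apply: le_trans (ler_mxnormD _ _) _; rewrite lerD2l.
Qed.

Lemma mxnormZ m n a (A : 'M[K]_(m, n)) : mxnorm (a *: A) = `|a| * mxnorm A.
Proof.
rewrite mulr_sumr; apply: eq_bigr => i _; rewrite mulr_sumr.
by apply: eq_bigr => j _; rewrite mxE normrM.
Qed.

Lemma ler_mxnormM m n p (A : 'M[K]_(m, n)) (B : 'M[K]_(n, p)) :
  mxnorm (A *m B) <= mxnorm A * mxnorm B.
Proof.
rewrite mulr_suml; apply: ler_sum => i _.
have le1 j : `|(A *m B) i j| <= \sum_k `|A i k| * `|B k j|.
  by rewrite mxE (le_trans (ler_norm_sum _ _ _)) //; under eq_bigr do rewrite normrM.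
apply: le_trans (ler_sum _ (fun j _ => le1 j)) _.
rewrite exchange_big mulr_suml; apply: ler_sum => k _ /=.
rewrite -mulr_sumr ler_wpM2l // /mxnorm (bigD1 k) //= lerDl.
by apply: sumr_ge0 => *; apply: sumr_ge0.
Qed.

(** If [Z] is killed by [1 + E] then [Z = - Z E], so the norm of [Z] is at most itself times that of
    [E]; this forces [Z = 0], and the kernel is trivial. *)
Lemma unitmx_mxnorm_lt1 n (E : 'M[K]_n) : mxnorm E < 1 -> 1%:M + E \in unitmx.
Proof.
move=> E1; rewrite -row_free_unit -kermx_eq0; apply/eqP.
set Z := kermx _; have : Z *m (1%:M + E) = 0 by exact: mulmx_ker.
rewrite mulmxDr mulmx1 => /eqP; rewrite addr_eq0 => /eqP ZE.
have := ler_mxnormM Z E; rewrite -(mxnormN (Z *m E)) -ZE => ?.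
apply: mxnorm_eq0; have := mxnorm_ge0 Z; nra.
Qed.

End EntrywiseNorm.

(** * Limits of matrices indexed by [m], as [eta] tends to 0 *)

Section Asymptotics.
Variables (K : realFieldType) (n : nat).
Local Notation index := {ffun 'I_n.+1 -> int}.

Definition admissible (eta : K) (m : index) : Prop :=
  1 < eta * (m ord0)%:~R /\
  forall j, j != ord0 -> `|(m j)%:~R| < eta * (m ord0)%:~R.

(** Membership in a filter describing the regime of small [eta]: as [admissible] is monotone in
    [eta], finite conjunctions are allowed. *)
Definition nearly (Q : index -> Prop) : Prop :=
  exists2 eta : K, 0 < eta & forall m, admissible eta m -> Q m.

Definition tends (X : index -> 'M[K]_n.+1) (L : 'M[K]_n.+1) : Prop :=
  forall e, 0 < e -> nearly (fun m => mxnorm (X m - L) <= e).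

Lemma admissible_gt0 eta m : 0 < eta -> admissible eta m -> 0 < (m ord0)%:~R :> K.
Proof. by move=> e0 [] h _; rewrite -(pmulr_rgt0 _ e0); lra. Qed.

Lemma admissible_le eta eta' m :
  0 < eta -> eta <= eta' -> admissible eta m -> admissible eta' m.
Proof.
move=> e0 le adm; have m0 := admissible_gt0 e0 adm; case: adm => h1 h2.
have le' : eta * (m ord0)%:~R <= eta' * (m ord0)%:~R by rewrite ler_pM2r.
by split=> [|j /h2]; [apply: lt_le_trans le' | move/lt_le_trans; apply].
Qed.

Lemma nearlyT (Q : index -> Prop) : (forall m, Q m) -> nearly Q.
Proof. by move=> h; exists 1 => // m _. Qed.

Lemma nearly_and (P Q : index -> Prop) :
  nearly P -> nearly Q -> nearly (fun m => P m /\ Q m).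
Proof.
move=> [a a0 Pa] [b b0 Qb]; exists (Num.min a b); first by rewrite lt_min a0 b0.
move=> m adm; split; [apply: Pa | apply: Qb]; move: adm; apply: admissible_le.
- by rewrite lt_min a0 b0.
- by rewrite ge_min lexx.
- by rewrite lt_min a0 b0.
- by rewrite ge_min lexx orbT.
Qed.

Lemma nearly_sub (P Q : index -> Prop) :
  (forall m, P m -> Q m) -> nearly P -> nearly Q.
Proof. by move=> PQ [a a0 Pa]; exists a => // m /Pa/PQ. Qed.

Lemma nearly_all (I : finType) (P : I -> index -> Prop) :
  (forall i, nearly (P i)) -> nearly (fun m => forall i, P i m).
Proof.
move=> h; suff : nearly (fun m => forall i, i \in enum I -> P i m).
  by apply: nearly_sub => m H i; apply: H; rewrite mem_enum.
elim: (enum I) => [|i s IH]; first exact: nearlyT.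
apply: nearly_sub (nearly_and (h i) IH) => m [Pi Ps] j.
by rewrite inE => /predU1P[->|/Ps].
Qed.

Lemma nearly_gt0 : nearly (fun m => 0 < (m ord0)%:~R :> K).
Proof. by exists 1 => // m; apply: admissible_gt0. Qed.

Lemma tends_cst L : tends (fun=> L) L.
Proof. by move=> e e0; apply: nearlyT => m; rewrite subrr mxnorm0 ltW. Qed.

Lemma eq_tends X Y L : nearly (fun m => X m = Y m) -> tends X L -> tends Y L.
Proof.
move=> eqXY hX e /hX/(nearly_and eqXY); apply: nearly_sub => m [-> //].
Qed.

Lemma tendsD X Y L L' :
  tends X L -> tends Y L' -> tends (fun m => X m + Y m) (L + L').
Proof.
move=> hX hY e e0; have e2 : 0 < e / 2 by lra.
apply: nearly_sub (nearly_and (hX _ e2) (hY _ e2)) => m [h1 h2].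
rewrite opprD addrACA; apply: le_trans (ler_mxnormD _ _) _; lra.
Qed.

Lemma tends_sum (I : Type) (r : seq I) (P : pred I)
    (X : I -> index -> 'M_n.+1) L :
  (forall i, P i -> tends (X i) (L i)) ->
  tends (fun m => \sum_(i <- r | P i) X i m) (\sum_(i <- r | P i) L i).
Proof.
move=> h; elim: r => [|i r IH].
  rewrite big_nil; apply: eq_tends (tends_cst _).
  by apply: nearlyT => m; rewrite big_nil.
rewrite big_cons; case: (boolP (P i)) => Pi; last first.
  by apply: eq_tends IH; apply: nearlyT => m; rewrite big_cons (negPf Pi).
apply: eq_tends (tendsD (h i Pi) IH).
by apply: nearlyT => m; rewrite big_cons Pi.
Qed.

Lemma tendsM X Y L L' :
  tends X L -> tends Y L' -> tends (fun m => X m *m Y m) (L *m L').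
Proof.
move=> hX hY e e0.
have a0 := mxnorm_ge0 L; have b0 := mxnorm_ge0 L'.
(* The summand [e] ensures [t <= 1], hence [t * t <= t]; the three error terms below then total at
   most [t] times [1 + mxnorm L + mxnorm L'], which is at most [t * c = e]. *)
pose c := 1 + e + mxnorm L + mxnorm L'; have c0 : 0 < c by rewrite /c; lra.
pose t := e / c; have t0 : 0 < t by rewrite divr_gt0.
have tc : t * c = e by rewrite /t divfK // gt_eqF.
apply: nearly_sub (nearly_and (hX _ t0) (hY _ t0)) => m [h1 h2].
have -> : X m *m Y m - L *m L' = (X m - L) *m (Y m - L') + (X m - L) *m L'
    + L *m (Y m - L').
  by rewrite -mulmxDr subrK mulmxBl mulmxBr addrA subrK.
apply: le_trans (ler_mxnormD _ _) _; rewrite -tc.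
have := le_trans (ler_mxnormD _ _)
  (lerD (ler_mxnormM (X m - L) (Y m - L')) (ler_mxnormM (X m - L) L')).
have := ler_mxnormM L (Y m - L').
have := mxnorm_ge0 (X m - L); have := mxnorm_ge0 (Y m - L').
move: (mxnorm (X m - L)) (mxnorm (Y m - L')) h1 h2 => x y h1 h2 y0 x0.
have xy : x * y <= t * t by rewrite ler_pM.
have xL : x * mxnorm L' <= t * mxnorm L' by rewrite ler_wpM2r.
have Ly : mxnorm L * y <= t * mxnorm L by rewrite mulrC ler_wpM2r.
have t1 : t <= 1 by rewrite ler_pdivrMr // mul1r /c; lra.
have tt : t * t <= t by rewrite -[leRHS]mulr1 ler_wpM2l // ltW.
have te : 0 <= t * e by rewrite mulr_ge0 ?ltW.
have -> : t * c = t + t * e + t * mxnorm L + t * mxnorm L'.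
  by rewrite /c !mulrDr mulr1.
lra.
Qed.

(** Invertibility near the identity comes from [unitmx_mxnorm_lt1]. The identity
    [X^-1 - 1 = - X^-1 (X - 1)] bounds the error in terms of the norm of [X^-1], which is in turn
    bounded by the error plus a constant; for [X] close to 1 the error can be absorbed. *)
Lemma tendsV X : tends X 1%:M ->
  nearly (fun m => X m \in unitmx) /\ tends (fun m => invmx (X m)) 1%:M.
Proof.
move=> hX; have unitX : nearly (fun m => X m \in unitmx).
  have h2 : 0 < 2^-1 :> K by lra.
  apply: nearly_sub (hX _ h2) => m h.
  have -> : X m = 1%:M + (X m - 1%:M) by rewrite addrC subrK.
  by apply: unitmx_mxnorm_lt1; lra.
split=> // e e0.
have a0 := mxnorm_ge0 (1%:M : 'M[K]_n.+1); set a := mxnorm _ in a0.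
(* The error [x] will satisfy [x <= (x + a) * t]; this [t] has [t < 1] and [a * t <= e * (1 - t)],
   which yields [x <= e]. *)
pose t := e / (a + e + 1); have d0 : 0 < a + e + 1 by lra.
have t0 : 0 < t by rewrite divr_gt0.
have te : t * (a + e + 1) = e by rewrite /t divfK // gt_eqF.
apply: nearly_sub (nearly_and unitX (hX _ t0)) => m [u h].
have eqV : invmx (X m) - 1%:M = - (invmx (X m) *m (X m - 1%:M)).
  by rewrite mulmxBr mulVmx // mulmx1 opprB.
have h1 : mxnorm (invmx (X m) - 1%:M) <= mxnorm (invmx (X m)) * t.
  rewrite eqV mxnormN; apply: le_trans (ler_mxnormM _ _) _.
  by rewrite ler_wpM2l // mxnorm_ge0.
have h2 : mxnorm (invmx (X m)) <= mxnorm (invmx (X m) - 1%:M) + a.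
  by have := ler_mxnormD (invmx (X m) - 1%:M) 1%:M; rewrite subrK.
have t1 : t < 1 by rewrite ltr_pdivrMr // mul1r; lra.
move: h1 h2; move: (mxnorm (invmx (X m) - 1%:M)) (mxnorm (invmx (X m))) => x y h1 h2.
have : y * t <= (x + a) * t by rewrite ler_wpM2r // ltW.
nra.
Qed.

(** The entry 1 in the maximum of the theorem gives [1 / m_1 < eta]. The norm [a] of the identity
    enters because scalars are viewed as scalar matrices. *)
Lemma tends_inv_ord0 : tends (fun m => ((m ord0)%:~R^-1)%:M) 0.
Proof.
move=> e e0; have a0 := mxnorm_ge0 (1%:M : 'M[K]_n.+1).
set a := mxnorm _ in a0; exists (e / (a + 1)); first by rewrite divr_gt0 //; lra.
have c0 : 0 < a + 1 by lra.
move=> m adm; have e'0 : 0 < e / (a + 1) by rewrite divr_gt0.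
have m0 := admissible_gt0 e'0 adm; case: adm => h _.
rewrite subr0 -scalemx1 mxnormZ -/a gtr0_norm ?invr_gt0 //.
rewrite mulrC ler_pdivrMr //; move: h; rewrite mulrAC ltr_pdivlMr // mul1r.
lra.
Qed.

Lemma tends_ratio j : j != ord0 ->
  tends (fun m => ((m ord0)%:~R^-1 * (m j)%:~R)%:M) 0.
Proof.
move=> j0 e e0; have a0 := mxnorm_ge0 (1%:M : 'M[K]_n.+1).
set a := mxnorm _ in a0; exists (e / (a + 1)); first by rewrite divr_gt0 //; lra.
have c0 : 0 < a + 1 by lra.
move=> m adm; have e'0 : 0 < e / (a + 1) by rewrite divr_gt0.
have m0 := admissible_gt0 e'0 adm; case: adm => _ /(_ j j0).
rewrite subr0 -scalemx1 mxnormZ -/a normrM gtr0_norm ?invr_gt0 // => h.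
rewrite -mulrA mulrC ler_pdivrMr //.
move: h; rewrite mulrAC ltr_pdivlMr //; move: (normr_ge0 ((m j)%:~R : K)); lra.
Qed.

End Asymptotics.

(** * Coordinates in the basis, and multiplication as real matrices *)

Section Coordinates.
Variables (K : realFieldType) (A : comNzRingType) (n : nat).
Variables (w : 'I_n.+1 -> A) (hw : is_Zbasis w).

Lemma Zcomb_ex x : exists m, x = Zcomb w m.
Proof. by have [m [h _]] := hw x; exists m. Qed.

Definition zcoord x : {ffun 'I_n.+1 -> int} := projT1 (cid (Zcomb_ex x)).

Lemma Zcomb_zcoord x : Zcomb w (zcoord x) = x.
Proof. by rewrite -(projT2 (cid (Zcomb_ex x))). Qed.

Lemma zcoord_Zcomb m : zcoord (Zcomb w m) = m.
Proof.
have [m' [_ u]] := hw (Zcomb w m).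
by rewrite -(u _ (esym (Zcomb_zcoord _))); apply: u.
Qed.

Definition rcoord x : 'rV[K]_n.+1 := \row_j (zcoord x j)%:~R.

Fact rcoord_is_zmod_morphism : zmod_morphism rcoord.
Proof.
move=> x y; apply/rowP => j; rewrite !mxE -rmorphB /=; congr (_%:~R).
rewrite -{1}(Zcomb_zcoord x) -{1}(Zcomb_zcoord y).
have -> : Zcomb w (zcoord x) - Zcomb w (zcoord y) =
    Zcomb w [ffun j => zcoord x j - zcoord y j].
  by rewrite /Zcomb -sumrB; apply: eq_bigr => i _; rewrite ffunE mulrzBr.
by rewrite zcoord_Zcomb ffunE.
Qed.

HB.instance Definition _ :=
  GRing.isZmodMorphism.Build A 'rV[K]_n.+1 rcoord rcoord_is_zmod_morphism.

Lemma rcoord_inj : injective rcoord.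
Proof.
move=> x y /rowP e; rewrite -(Zcomb_zcoord x) -(Zcomb_zcoord y); congr Zcomb.
by apply/ffunP => j; have := e j; rewrite !mxE => /intr_inj.
Qed.

Lemma rcoord_Zcomb m : rcoord (Zcomb w m) = \row_j (m j)%:~R.
Proof. by apply/rowP => j; rewrite !mxE zcoord_Zcomb. Qed.

Lemma rcoord_basis i : rcoord (w i) = delta_mx 0 i.
Proof.
have -> : w i = Zcomb w [ffun j => (j == i)%:Z].
  rewrite /Zcomb (bigD1 i) //= ffunE eqxx big1 ?addr0 // => j /negPf ji.
  by rewrite ffunE ji.
by rewrite rcoord_Zcomb; apply/rowP => j; rewrite !mxE ffunE eqxx /= eq_sym.
Qed.

(** The regular representation, with the images of the basis as rows so that it acts on coordinate
    row vectors from the right. Inverting these matrices replaces division in the algebra obtained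
    by extending scalars to [K]. *)
Definition mulop a : 'M[K]_n.+1 := \matrix_i rcoord (a * w i).

Lemma rcoordM x a : rcoord (x * a) = rcoord x *m mulop a.
Proof.
rewrite -{1}(Zcomb_zcoord x) mulr_suml raddf_sum mulmx_sum_row.
apply: eq_bigr => i _; rewrite rowK mxE scaler_int mulrzAl raddfMz.
by rewrite mulrC.
Qed.

Fact mulop_is_zmod_morphism : zmod_morphism mulop.
Proof.
by move=> a b; apply/row_matrixP => i; rewrite [RHS]linearB /= !rowK mulrBl raddfB.
Qed.

Fact mulop_is_monoid_morphism : monoid_morphism mulop.
Proof.
split=> [|a b]; apply/row_matrixP => i.
  by rewrite rowK mul1r rcoord_basis row1.
by rewrite row_mul !rowK -rcoordM mulrAC.
Qed.

HB.instance Definition _ :=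
  GRing.isZmodMorphism.Build A 'M[K]_n.+1 mulop mulop_is_zmod_morphism.
HB.instance Definition _ :=
  GRing.isMonoidMorphism.Build A 'M[K]_n.+1 mulop mulop_is_monoid_morphism.

End Coordinates.

(** * Coefficients of a shifted polynomial *)

Section Taylor.
Variable A : comNzRingType.

Lemma coef_comp_XaddC (p : {poly A}) a j :
  (p \Po ('X + a%:P))`_j = (p^`N(j)).[a].
Proof.
have -> : p \Po ('X + a%:P) = \poly_(i < size p) (p^`N(i)).[a].
  (* Composition is evaluation of [p], mapped to coefficients in [{poly A}], at [a%:P + 'X];
     Taylor's formula is used there with increment ['X]. *)
  rewrite /comp_poly addrC nderiv_taylor; last exact: mulrC.
  rewrite size_map_polyC poly_def; apply: eq_bigr => i _.
  by rewrite nderivn_map horner_map mul_polyC.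
rewrite coef_poly; case: ltnP => // hj.
by rewrite nderivn_poly0 // horner0.
Qed.

End Taylor.

(** * Asymptotics of the coefficients of [p(x + alpha)] *)

Section Leading.
Variables (K : realFieldType) (A : comNzRingType) (n : nat).
Variables (w : 'I_n.+1 -> A) (hw : is_Zbasis w) (hw1 : w ord0 = 1).
Local Notation mulop := (@mulop K A n w hw).
Local Notation lead m := ((m (ord0 : 'I_n.+1))%:~R : K).

Lemma tendsZ_inv (X : {ffun 'I_n.+1 -> int} -> 'M[K]_n.+1) L :
  tends X L -> tends (fun m => (lead m)^-1 *: X m) 0.
Proof.
move/(tendsM (@tends_inv_ord0 K n)); rewrite mul0mx; apply: eq_tends.
by apply: nearlyT => m; rewrite mul_scalar_mx.
Qed.

Lemma tendsZ_invX (X : {ffun 'I_n.+1 -> int} -> 'M[K]_n.+1) L d :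
  tends X L -> tends (fun m => (lead m)^-1 ^+ d.+1 *: X m) 0.
Proof.
move=> hX; elim: d => [|d IH]; first exact: tendsZ_inv hX.
by apply: eq_tends (tendsZ_inv IH); apply: nearlyT => m; rewrite scalerA -exprS.
Qed.

(** Since the first basis element is 1, [alpha / m_1] is 1 plus a combination of the other [w i]
    with coefficients [m_i / m_1], which tend to 0. *)
Lemma tends_mulop_Zcomb :
  tends (fun m => (lead m)^-1 *: mulop (Zcomb w m)) 1%:M.
Proof.
have h i : i != ord0 -> tends (fun m : {ffun 'I_n.+1 -> int} =>
    ((lead m)^-1 * (m i)%:~R)%:M *m mulop (w i)) 0.
  move=> i0; rewrite -(mul0mx _ (mulop (w i))).
  exact: tendsM (@tends_ratio K n i i0) (tends_cst _).
have := tendsD (tends_cst 1%:M) (tends_sum (index_enum _) h).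
rewrite big1 // addr0; apply: eq_tends.
apply: nearly_sub (nearly_gt0 K n) => m m0.
rewrite [Zcomb w m](bigD1 ord0) //= hw1 rmorphD rmorph_sum scalerDr scaler_sumr.
congr (_ + _).
  rewrite rmorphMz -[X in _ *: X]scaler_int scalerA mulVf ?gt_eqF //.
  by rewrite scale1r [RHS]rmorph1.
apply: eq_bigr => i _; rewrite rmorphMz -[X in _ *: X]scaler_int scalerA.
by rewrite mul_scalar_mx.
Qed.

(** Horner's scheme: for [g = g' X + c], dividing [g(alpha)] by [m_1^(d+1)] gives
    [g'(alpha) / m_1^d] times [alpha / m_1], plus a term that vanishes in the limit. *)
Lemma tends_mulop_horner (g : {poly A}) (d : nat) : (size g <= d.+1)%N ->
  tends (fun m => (lead m)^-1 ^+ d *: mulop g.[Zcomb w m]) (mulop g`_d).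
Proof.
elim: d g => [|d IH] g sg.
  rewrite (size1_polyC sg) coefC; apply: eq_tends (tends_cst _).
  by apply: nearlyT => m; rewrite hornerC expr0 scale1r.
have [g' [c gE]] : exists g' c, g = g' * 'X + c%:P.
  by elim/poly_ind: (g) => [|g' c _]; [exists 0, 0 | exists g', c];
     rewrite ?mul0r ?addr0.
have sg' : (size g' <= d.+1)%N.
  move: sg; rewrite gE size_MXaddC; case: ifP => // /andP[/eqP-> _].
  by rewrite size_poly0.
have -> : g`_d.+1 = g'`_d by rewrite gE coefD coefMX coefC addr0.
have := tendsD (tendsM (IH g' sg') tends_mulop_Zcomb)
  (tendsZ_invX d (tends_cst (mulop c))).
rewrite mulmx1 addr0; apply: eq_tends; apply: nearlyT => m.
rewrite gE hornerMXaddC rmorphD rmorphM scalerDr; congr (_ + _).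
by rewrite -scalemxAl -scalemxAr scalerA exprSr.
Qed.

Lemma shift_coefs_small (p : {poly A}) (d : nat) (e : K) :
    p \is monic -> size p = d.+1 -> 0 < e ->
  nearly K (fun m : {ffun 'I_n.+1 -> int} =>
    let q := p \Po ('X + (Zcomb w m)%:P) in
    mulop q`_0 \in unitmx /\
    forall j : 'I_d, let P := mulop q`_j.+1 *m invmx (mulop q`_0) in
      mxnorm P <= e /\ 0 <= P ord0 ord0).
Proof.
move=> mp sp e0.
have pd : p`_d = 1 by have := monicP mp; rewrite /lead_coef sp.
(* [Q j] is the coefficient of [x^j] in [p(x + alpha)], normalised by [m_1^(d-j)]. As [p] is monic,
   the degree [d - j] coefficient of the divided derivative is the binomial coefficient, which is
   the limit. *)
pose Q j (m : {ffun 'I_n.+1 -> int}) : 'M[K]_n.+1 :=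
  (lead m)^-1 ^+ (d - j) *: mulop (p^`N(j)).[Zcomb w m].
have tQ j : (j <= d)%N -> tends (Q j) ('C(d, j)%:R)%:M.
  move=> jd; have -> : ('C(d, j)%:R)%:M = mulop (p^`N(j))`_(d - j).
    by rewrite coef_nderivn subnKC // pd -scalemx1 scaler_nat
       [RHS]rmorphMn [in RHS]rmorph1.
  apply: tends_mulop_horner; apply/leq_sizeP => i hi.
  rewrite coef_nderivn nth_default ?mul0rn // sp; lia.
have tQ0 : tends (Q 0%N) 1%:M by have := tQ 0%N isT; rewrite bin0.
have [unitQ invQ] := tendsV tQ0.
have tP (j : 'I_d) := tendsM (tQ j.+1 (ltn_ord j)) invQ.
have h1 : 0 < 1 :> K by [].
(* The limit of [Q j.+1] times the inverse of [Q 0] serves twice: with tolerance 1 it controls the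
   sign, and after multiplication by [m_1^-(j+1)] it controls the size. *)
have := nearly_and (nearly_and (nearly_gt0 K n) unitQ)
  (nearly_and (nearly_all (fun j : 'I_d => tP j 1 h1))
     (nearly_all (fun j : 'I_d => tendsZ_invX j (tP j) e0))).
apply: nearly_sub => m [[m0 uQ] [near1 near0]] q.
have lead0 : lead m != 0 by rewrite gt_eqF.
have u0 : mulop q`_0 \in unitmx.
  move: uQ; rewrite /Q subn0 -coef_comp_XaddC unitmxZ //.
  by rewrite unitfE expf_neq0 ?invr_eq0.
split=> // j P.
have PE : P = (lead m)^-1 ^+ j.+1 *: (Q j.+1 m *m invmx (Q 0%N m)).
  rewrite /Q -!coef_comp_XaddC subn0 invmxZ; last first.
    by rewrite unitmxZ // unitfE expf_neq0 ?invr_eq0.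
  rewrite -scalemxAl -scalemxAr !scalerA -[P]scale1r; congr (_ *: _).
  rewrite -exprD subnKC // -exprVn invrK -exprMn mulVf // expr1n.
  by [].
have := near0 j; rewrite subr0 PE => ?; split=> //; rewrite mxE mulr_ge0 //.
  by rewrite exprn_ge0 // invr_ge0 ltW.
(* The corner entry is within 1 of a binomial coefficient that is at least 1, hence nonnegative. *)
have := le_trans (ler_mxnorm_entry _ ord0 ord0) (near1 j).
rewrite mulmx1; move: (Q _ m *m _) => Y.
rewrite !mxE eqxx mulr1n ler_norml => /andP[+ _].
have : 1 <= 'C(d, j.+1)%:R :> K by rewrite ler1n bin_gt0.
lra.

Qed.

End Leading.

(** * Extinction of the integer orbit of the recurrence *)

Section Dynamics.
Variables (K : archiRealFieldType) (n d : nat).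

Lemma eventually_le_of_contraction (v : nat -> K) (N : nat) (B : K) :
    0 <= B -> (forall i, 0 <= v i) -> (d <= N)%N ->
    (forall i T, (N <= i)%N -> 0 <= T ->
      (forall j : 'I_d, v (i - j.+1)%N <= T) -> v i <= B + T / 2) ->
  exists N1, forall i, (N1 <= i)%N -> v i <= 2 * B + 1.
Proof.
move=> B0 v0 dN hv; pose t := \sum_(i < N) v i.
have t0 : 0 <= t by apply: sumr_ge0.
(* [2 * B] is the fixed point of [T -> B + T / 2], so it is the excess over [2 * B] that is
   halved. *)
have step i T : (N <= i)%N -> 0 <= T ->
    (forall j : 'I_d, v (i - j.+1)%N <= 2 * B + T) -> v i <= 2 * B + T / 2.
  move=> Ni T0 hT; have T'0 : 0 <= 2 * B + T by lra.
  by have := hv i _ Ni T'0 hT; lra.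
have bnd i : v i <= 2 * B + t.
  elim/ltn_ind: i => i IH; case: (ltnP i N) => Ni.
    have : v i <= t.
      by rewrite /t (bigD1 (Ordinal Ni)) //= lerDl sumr_ge0.
    lra.
  have := step i t Ni t0; have h (j : 'I_d) : v (i - j.+1)%N <= 2 * B + t.
    by apply: IH; have := ltn_ord j; lia.
  by move/(_ h); lra.
(* Each halving needs the previous [d] values to obey the current bound, so it costs [d] further
   indices. *)
have decay k : exists N1, forall i, (N1 <= i)%N -> v i <= 2 * B + t / 2 ^+ k.
  elim: k => [|k [N1 IH]]; first by exists 0%N => i _; rewrite expr0 divr1.
  exists (maxn N (N1 + d)) => i; rewrite geq_max => /andP[Ni N1i].
  rewrite exprSr invfM mulrA; apply: step => // [|j].
    by rewrite mulr_ge0 // invr_ge0 exprn_ge0 //; lra.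
  by apply: IH; have := ltn_ord j; lia.
have [k tk] : exists k : nat, t / 2 ^+ k <= 1.
  exists (Num.bound t); rewrite ler_pdivrMr ?exprn_gt0 // mul1r.
  apply: le_trans (ltW (archi_boundP t0)) _.
  by rewrite -natrX ler_nat ltnW // ltn_expl.
have [N1 h] := decay k; exists N1 => i /h; lra.
Qed.

Definition introw (z : {ffun 'I_n.+1 -> int}) : 'rV[K]_n.+1 := \row_j (z j)%:~R.

Lemma introw0 : introw 0 = 0.
Proof. by apply/rowP => j; rewrite !mxE ffunE. Qed.

Definition neg_e1 : {ffun 'I_n.+1 -> int} := [ffun j => - (j == ord0)%:Z].

Lemma introw_neg_e1 : introw neg_e1 = - delta_mx 0 ord0.
Proof. by apply/rowP => j; rewrite !mxE ffunE rmorphN; case: (j == _). Qed.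

(** The bound on [e *+ d] by one half provides the contraction that brings the orbit below
    [2 * B + 1]; the last inequality then places the linear terms in the [eps]-neighbourhood where
    [F] is known. *)
Lemma orbit_eventually0 (F : 'rV[K]_n.+1 -> Prop)
    (c : nat -> {ffun 'I_n.+1 -> int}) (P : 'I_d -> 'M[K]_n.+1)
    (N : nat) (B eps e : K) :
    (forall x z z', F (x - introw z) -> F (x - introw z') -> z = z') ->
    (forall x, F x -> mxnorm x <= B) ->
    (forall x, mxnorm x < eps -> F x \/ F (x + delta_mx 0 ord0)) ->
    (forall x, mxnorm x < eps -> 0 <= x 0 ord0 -> F x) ->
    0 <= B -> (d <= N)%N ->
    (forall i, (N <= i)%N ->
      F (- (\sum_(j < d) introw (c (i - j.+1)%N) *m P j) - introw (c i))) ->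
    (forall j, mxnorm (P j) <= e /\ 0 <= P j ord0 ord0) ->
    e *+ d <= 2^-1 -> (2 * B + 1) * (e *+ d) < eps ->
  exists N1, forall i, (N1 <= i)%N -> c i = 0.
Proof.
move=> uF bF F0 F0p B0 dN hc hP e1 e2.
pose r i := \sum_(j < d) introw (c (i - j.+1)%N) *m P j.
have normr_le i T : 0 <= T ->
    (forall j : 'I_d, mxnorm (introw (c (i - j.+1)%N)) <= T) ->
    mxnorm (r i) <= T * (e *+ d).
  move=> T0 hT; apply: le_trans (ler_mxnorm_sum _ _ _) _.
  have -> : T * (e *+ d) = \sum_(j < d) T * e.
    by rewrite sumr_const card_ord mulrnAr.
  apply: ler_sum => j _; apply: le_trans (ler_mxnormM _ _) _.
  by rewrite ler_pM ?mxnorm_ge0 //; case: (hP j).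
have [N1 bnd] : exists N1, forall i, (N1 <= i)%N ->
    mxnorm (introw (c i)) <= 2 * B + 1.
  apply: (@eventually_le_of_contraction _ N) => // [i|i T Ni T0 hT].
    exact: mxnorm_ge0.
  have -> : introw (c i) = - (- r i - introw (c i)) - r i.
    by rewrite opprD !opprK addrAC subrr add0r.
  apply: le_trans (ler_mxnormD _ _) _; rewrite !mxnormN.
  have := bF _ (hc i Ni); have := normr_le i T T0 hT.
  have : T * (e *+ d) <= T * 2^-1 by rewrite ler_wpM2l.
  rewrite -/(r i); lra.
have small i : (N1 + d <= i)%N -> mxnorm (- r i) < eps.
  move=> hi; rewrite mxnormN; apply: le_lt_trans e2; apply: normr_le; first lra.
  by move=> j; apply: bnd; have := ltn_ord j; lia.
pose N2 := maxn N (N1 + d).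
have digit01 i : (N2 <= i)%N -> c i = 0 \/ c i = neg_e1.
  rewrite geq_max => /andP[Ni N1i]; case: (F0 _ (small i N1i)) => hF; [left|right].
    by apply: (uF (- r i)); rewrite ?introw0 ?subr0 //; apply: hc.
  by apply: (uF (- r i)); rewrite ?introw_neg_e1 ?opprK //; apply: hc.
exists (N2 + d)%N => i hi.
have [Ni N1i] : (N <= i)%N /\ (N1 + d <= i)%N.
  by move: hi; rewrite /N2; lia.
apply: (uF (- r i)); first exact: hc.
rewrite introw0 subr0; apply: F0p (small i N1i) _.
(* The preceding [d] values are all 0 or [neg_e1], so each summand of [r i] has first coordinate 0
   or minus a corner entry [P j ord0 ord0]; the half-space hypothesis thus applies to [- r i]. *)
rewrite mxE oppr_ge0 summxE; apply: sumr_le0 => j _.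
have /digit01 : (N2 <= i - j.+1)%N by have := ltn_ord j; lia.
case=> ->; first by rewrite introw0 mul0mx mxE.
rewrite introw_neg_e1 mulNmx -rowE !mxE oppr_le0.
by case: (hP j).
Qed.

End Dynamics.

(** * Greedy division from the constant term upwards *)

Section GreedyDivision.
Variables (A : comNzRingType) (q a : {poly A}) (fl : A -> A).

Fixpoint greedy_quot k : {poly A} :=
  if k is k'.+1 then
    greedy_quot k' + (fl (a - greedy_quot k' * q)`_k')%:P * 'X^k'
  else 0.

Definition greedy_coef k : A := fl (a - greedy_quot k * q)`_k.

Lemma coef_greedy_quot k i :
  (greedy_quot k)`_i = if (i < k)%N then greedy_coef i else 0.
Proof.
elim: k => [|k IH] /=; first by rewrite coef0.
rewrite coefD IH coefCM coefXn ltnS; case: ltngtP => [ik|ik|->].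
- by rewrite mulr0 addr0.
- by rewrite mulr0 addr0.
- by rewrite mulr1 add0r.
Qed.

(** Quotient terms of degree above [i] do not reach coefficient [i], so the value fixed at step [i]
    survives all later steps. *)
Lemma coef_greedy_rem k i : (i < k)%N ->
  (a - greedy_quot k * q)`_i =
    (a - greedy_quot i * q)`_i - q`_0 * greedy_coef i.
Proof.
move=> ik; rewrite !coefB -addrA -opprD; congr (_ - _).
rewrite !coefM !big_ord_recr /= !coef_greedy_quot ik ltnn subnn mul0r addr0.
rewrite [q`_0 * _]mulrC; congr (_ + _); apply: eq_bigr => j _.
by rewrite !coef_greedy_quot ltn_ord (ltn_trans _ ik).
Qed.

Lemma coef_greedy_rem_diag d i : (size q <= d.+1)%N -> (size a <= i)%N ->
    (d <= i)%N ->
  (a - greedy_quot i * q)`_i =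
    - \sum_(j < d) greedy_coef (i - j.+1) * q`_j.+1.
Proof.
move=> sq sa di; rewrite coefB nth_default // add0r; congr (- _).
rewrite coefMr big_ord_recl subn0 coef_greedy_quot ltnn mul0r add0r.
(* The convolution runs over all [i] earlier quotient coefficients; those with [j >= d] meet
   vanishing coefficients of [q]. *)
rewrite (big_ord_widen i (fun j => greedy_coef (i - j.+1) * q`_j.+1)) //.
rewrite [RHS]big_mkcond; apply: eq_bigr => j _ /=.
rewrite /bump /= add1n coef_greedy_quot.
have -> : (i - j.+1 < i)%N by have := ltn_ord j; lia.
case: ltnP => // dj; rewrite [q`_j.+1]nth_default ?mulr0 //.
exact: leq_trans sq _.
Qed.

Lemma greedy_quot_stable N k : (forall i, (N <= i)%N -> greedy_coef i = 0) ->
  (N <= k)%N -> greedy_quot k = greedy_quot N.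
Proof.
move=> h Nk; apply/polyP => i; rewrite !coef_greedy_quot.
case: (ltnP i N) => iN; first by rewrite (leq_trans iN Nk).
by rewrite h // if_same.
Qed.

End GreedyDivision.

(** * Digit sets, residue systems and the finiteness criterion *)

Lemma intRE z : intR z = z%:~R.
Proof. by case: z => k; rewrite /intR INRE. Qed.

Section DigitSets.
Variables (A : comNzRingType) (n : nat) (w : 'I_n.+1 -> A) (hw : is_Zbasis w).
Variable F : rvec n.+1 -> Prop.
Local Notation mulop := (@mulop R A n w hw).
Local Notation rcoord := (@rcoord R A n w hw).

Definition rowset (x : 'rV[R]_n.+1) : Prop := F (fun i => x 0 i).

Lemma rowset_row f : rowset (\row_i f i) = F f.
Proof. by congr F; apply/funext => i; rewrite mxE. Qed.

(** The structure constants in [DF] are, by uniqueness of coordinates, the entries of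
    [mulop theta]. *)
Lemma DFE theta beta : DF w F theta beta <->
  exists2 f, rowset f & rcoord beta = f *m mulop theta.
Proof.
split=> [[f [Ff [b [c [-> [hc hb]]]]]]|[f Ff e]].
  exists (\row_i f i); first by rewrite rowset_row.
  rewrite rcoord_Zcomb; apply/rowP => l; rewrite !mxE -intRE hb.
  apply: eq_bigr => j _; rewrite !mxE hc zcoord_Zcomb intRE.
  exact: mulrC.
exists (fun i => f 0 i); split=> //.
exists (zcoord hw beta), (fun j => zcoord hw (theta * w j)).
split; first by rewrite Zcomb_zcoord.
split=> [j|l]; first by rewrite Zcomb_zcoord.
have := congr1 (fun x : 'rV_n.+1 => x 0 l) e; rewrite !mxE intRE => ->.
by apply: eq_bigr => j _; rewrite !mxE intRE; apply: mulrC.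
Qed.

Hypothesis hF : fundamental_domain F.

Lemma rowset_unique x z z' :
  rowset (x - introw R z) -> rowset (x - introw R z') -> z = z'.
Proof.
have [z0 [_ u]] := hF (fun i => x 0 i).
have h y : rowset (x - introw R y) -> z0 = y.
  by move=> Fy; apply: u; congr F: Fy; apply/funext => i; rewrite !mxE intRE.
by move=> /h <- /h.
Qed.

Lemma rowset_floor x : exists z, rowset (x - introw R z).
Proof.
have [z [h _]] := hF (fun i => x 0 i); exists z.
by congr F: h; apply/funext => i; rewrite !mxE intRE.
Qed.

Variable theta : A.
Hypothesis utheta : mulop theta \in unitmx.

Lemma DF_floor x : exists y, DF w F theta (x - theta * y).
Proof.
have [z hz] := rowset_floor (rcoord x *m invmx (mulop theta)).
exists (Zcomb w z); apply/DFE.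
exists (rcoord x *m invmx (mulop theta) - introw R z) => //.
by rewrite mulmxBl mulmxKV // raddfB mulrC /= rcoordM rcoord_Zcomb.
Qed.

(** Two digits in one residue class, divided by [theta], give points of the domain differing by an
    integer vector; disjointness of translates identifies them. *)
Lemma DF_complete : complete_residue_system theta (DF w F theta).
Proof.
move=> x; have [y hy] := DF_floor x; exists (x - theta * y); split.
  by split=> //; exists y; rewrite subKr.
move=> d [hd [y' e]].
have [f Ff fE] := (DFE _ _).1 hy; have [f' Ff' fE'] := (DFE _ _).1 hd.
have dE : d = x - theta * y' by rewrite -e subKr.
have f'E : f' = f - introw R (zcoord hw (y' - y)).
  apply: (can_inj (mulmxK utheta)).
  rewrite mulmxBl -fE -fE' -[introw _ _]/(rcoord _) -rcoordM -raddfB dE.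
  by congr rcoord; rewrite mulrBl [y' * _]mulrC [y * _]mulrC opprB addrA subrK.
have e0 : zcoord hw (y' - y) = 0.
  by apply: (@rowset_unique f); [rewrite -f'E | rewrite introw0 subr0].
have : y' - y = 0.
  apply: (@rcoord_inj R _ _ _ hw); rewrite raddf0 -[LHS]/(introw R (zcoord hw _)).
  by rewrite e0 introw0.
by move/eqP; rewrite subr_eq0 dE => /eqP ->.
Qed.

End DigitSets.

(** The coordinates of the greedy quotient coefficients form an orbit as in [orbit_eventually0].
    Once they vanish, the quotient is a fixed polynomial and the remainder is the digit expansion of
    [a]. *)
Lemma finiteness_of_digits (A : idomainType) (n d : nat) (w : 'I_n.+1 -> A)
    (hw : is_Zbasis w) (F : rvec n.+1 -> Prop) (q : {poly A}) (B eps e : R)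
    (M := @mulop R A n w hw) :
    fundamental_domain F ->
    (forall x, rowset F x -> mxnorm x <= B) ->
    (forall x : 'rV_n.+1, mxnorm x < eps ->
      rowset F x \/ rowset F (x + delta_mx 0 ord0)) ->
    (forall x : 'rV_n.+1, mxnorm x < eps -> 0 <= x 0 ord0 -> rowset F x) ->
    0 <= B -> 0 < eps -> e *+ d <= 2^-1 -> (2 * B + 1) * (e *+ d) < eps ->
    q \is monic -> (size q <= d.+1)%N -> M q`_0 \in unitmx ->
    (forall j : 'I_d, let P := M q`_j.+1 *m invmx (M q`_0) in
      mxnorm P <= e /\ 0 <= P ord0 ord0) ->
  finiteness_property q (DF w F q`_0).
Proof.
move=> hF bF F0 F0p B0 eps0 e1 e2 mq sq uq hP.
split=> //; split; first by rewrite horner_coef0; apply: (DF_complete hF uq).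
split.
  apply/(DFE hw); exists 0; last by rewrite raddf0 mul0mx.
  by apply: F0p; rewrite ?mxnorm0 ?mxE.
move=> a.
have [fl hfl] := choice (DF_floor hF uq).
pose c := greedy_coef q a fl; pose C := greedy_quot q a fl.
have digit i : DF w F q`_0 ((a - C i * q)`_i - q`_0 * c i) by apply: hfl.
have [N1 hN1] : exists N1, forall i, (N1 <= i)%N -> zcoord hw (c i) = 0.
  apply: (@orbit_eventually0 _ n d (rowset F) _
    (fun j : 'I_d => M q`_j.+1 *m invmx (M q`_0)) (size a + d) B eps e) => //.
  - by move=> x z z'; apply: rowset_unique.
  - exact: leq_addl.
  move=> i hi; have [f Ff fE] := (DFE hw F _ _).1 (digit i); congr rowset: Ff.
  apply: (can_inj (mulmxK uq)); rewrite -fE.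
  have [sa di] : (size a <= i)%N /\ (d <= i)%N by lia.
  rewrite (coef_greedy_rem_diag fl sq sa di).
  rewrite raddfB /= raddfN /= raddf_sum mulmxBl mulNmx; congr (- _ - _).
    rewrite mulmx_suml; apply: eq_bigr => j _.
    by rewrite -!mulmxA mulVmx // mulmx1 -rcoordM.
  by rewrite mulrC rcoordM.
have c0 i : (N1 <= i)%N -> c i = 0.
  move=> /hN1 h; rewrite -(Zcomb_zcoord hw (c i)) h.
  by apply: big1 => j _; rewrite ffunE.
(* The length must reach the point where the quotient is stable and also cover the whole
   remainder. *)
pose l := maxn N1 (size (a - C N1 * q)).
have Cl : C l = C N1 by apply: greedy_quot_stable (leq_maxl _ _).
exists l, (fun j => (a - C l * q)`_j); split=> [j|].
  by rewrite coef_greedy_rem.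
exists (C l); rewrite (_ : \sum_(j < l) _ = a - C l * q) ?subKr //.
have sl : (size (a - C l * q)%R <= l)%N by rewrite Cl leq_maxr.
rewrite -[RHS](take_poly_id sl) /take_poly poly_def.
by apply: eq_bigr => j _; rewrite mul_polyC.
Qed.

(** * Choice of constants and conclusion *)

Lemma bounded_rowset n (F : rvec n.+1 -> Prop) : bounded_set F ->
  exists2 B : R, 0 <= B & forall x, rowset F x -> mxnorm x <= B.
Proof.
move=> [B hB]; exists (`|B| *+ n.+1) => [|x Fx]; first by rewrite mulrn_wge0.
rewrite /mxnorm big_ord1 -[X in _ *+ X]card_ord -sumr_const.
apply: ler_sum => j _; have /RleP := hB _ Fx j; rewrite RabsE => h.
exact: le_trans h (ler_norm B).
Qed.

Theorem mainTheorem9 (A : idomainType) (k : nat) (w : 'I_k.+1 -> A)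
  (hw : is_Zbasis w) (hw1 : w ord0 = 1)
  (p : {poly A}) (hp : p \is monic)
  (F : rvec k.+1 -> Prop) (hF : fundamental_domain F) (hFb : bounded_set F)
  (h0 : in_interior (fun v => F v \/ F (radd v (@e1 k))) (@rzero k.+1))
  (h0p : in_interior_plus F (@rzero k.+1)) :
  exists eta : R, Rlt R0 eta /\
    forall m : {ffun 'I_k.+1 -> int},
      Rlt R1 (Rmult eta (intR (m ord0))) ->
      (forall j : 'I_k.+1, j != ord0 ->
         Rlt (Rabs (intR (m j))) (Rmult eta (intR (m ord0)))) ->
      finiteness_property (p \Po ('X + (Zcomb w m)%:P))
                          (DF w F p.[Zcomb w m]).
Proof.
have [B B0 hB] := bounded_rowset hFb.
have [eps1 [/RltP eps1_gt0 hF1]] := h0.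
have [_ [eps2 [/RltP eps2_gt0 hF2]]] := h0p.
pose eps := Num.min eps1 eps2.
have eps0 : 0 < eps by rewrite lt_min eps1_gt0 eps2_gt0.
have near (r : R) (x : 'rV[R]_k.+1) : mxnorm x < r ->
    forall i, Rlt (Rabs (Rminus (x 0 i) (rzero i))) r.
  move=> xr i; apply/RltP; rewrite RabsE RminusE subr0.
  exact: le_lt_trans (ler_mxnorm_entry x 0 i) xr.
have F0 (x : 'rV[R]_k.+1) : mxnorm x < eps ->
    rowset F x \/ rowset F (x + delta_mx 0 ord0).
  rewrite lt_min => /andP[/near/hF1 + _] => -[h|h]; [by left|right].
  congr F: h; apply/funext => i; rewrite /radd /e1 !mxE.
  by case: (i == ord0).
have F0p (x : 'rV[R]_k.+1) : mxnorm x < eps -> 0 <= x 0 ord0 -> rowset F x.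
  rewrite lt_min => /andP[_ /near h] /RleP x0; exact: hF2.
have [d sp] : exists d, size p = d.+1.
  by exists (size p).-1; rewrite prednK // size_poly_gt0 monic_neq0.
(* The two bounds on [t] match the two smallness conditions on [e *+ d]; the extra factor 2 makes
   the second strict. Dividing by [d.+1] below also covers [d = 0], that is [p = 1]. *)
pose t := Num.min 2^-1 (eps / (2 * (2 * B + 1))).
have t0 : 0 < t by rewrite lt_min invr_gt0 ltr0n divr_gt0 //; lra.
pose e := t / d.+1%:R.
have e0 : 0 < e by rewrite divr_gt0.
have edt : e *+ d <= t.
  rewrite -mulr_natr mulrAC ler_pdivrMr // ler_wpM2l ?ler_nat //; lra.
have [eta eta0 heta] := shift_coefs_small hw hw1 hp sp e0.
exists eta; split=> [|m m1 m2]; first exact/RltP.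
have adm : admissible eta m.
  split; first by move/RltP: m1; rewrite intRE.
  by move=> j /m2/RltP; rewrite RabsE !intRE.
have [u hP] := heta m adm.
have sX : size ('X + (Zcomb w m)%:P) = 2%N by rewrite size_XaddC.
have -> : p.[Zcomb w m] = (p \Po ('X + (Zcomb w m)%:P))`_0.
  by rewrite coef_comp_XaddC nderivn0.
apply: (finiteness_of_digits hF hB F0 F0p B0 eps0 _ _ _ _ u hP).
- by apply: le_trans edt _; rewrite ge_min lexx.
- have t2 : t <= eps / (2 * (2 * B + 1)) by rewrite ge_min lexx orbT.
  apply: le_lt_trans (_ : (2 * B + 1) * t < _).
    by rewrite ler_wpM2l //; lra.
  move: t2; rewrite ler_pdivlMr; lra.
- apply/monicP; rewrite lead_coef_comp ?sX // lead_coefXaddC expr1n mulr1.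
  exact/monicP.
- by rewrite size_comp_poly2 // sp.
Qed.
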